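(* A topological space is irreducible if and only if it is nonempty, connected, and locally irreducible.
   Context: A topological space is irreducible if the intersection of finitely many nonempty open subsets is nonempty, equivalently if the union of finitely many proper closed subsets is a proper subset (taking the empty family, irreducible spaces are nonempty). A subset is irreducible if it is so with the induced topology. A space is locally irreducible if every point has an irreducible neighbourhood (equivalently, an irreducible open neighbourhood). The empty space is considered connected and locally irreducible. *)

(* Defs.v *)
From mathcomp Require Import all_boot all_order all_algebra.
From mathcomp Require Import all_classical.
From mathcomp Require Import topology.

Set Implicit Arguments.
Unset Strict Implicit.
Unset Printing Implicit Defensive.

Local Open Scope classical_set_scope.

(* [F] may be empty: the intersection is then the whole space, so that an
   irreducible space is nonempty. *)
Definition irreducible_space (T : topologicalType) : Prop :=
  forall F : set (set T), finite_set F ->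
    (forall U, F U -> open U /\ U !=set0) ->
    \bigcap_(U in F) U !=set0.

(* [set_type A] carries the initial topology of the inclusion into [T]. The
   library's [subspace A] would be wrong here: it has carrier [T] and makes the
   points outside [A] isolated. *)
Definition irreducible_set (T : topologicalType) (A : set T) : Prop :=
  irreducible_space (set_type A).

(* Neighbourhoods are not required to be open. *)
Definition locally_irreducible (T : topologicalType) : Prop :=
  forall x : T, exists2 V : set T, nbhs x V & irreducible_set V.

(* Main.v *)
Require Import Defs.
From mathcomp Require Import all_boot all_order all_algebra.
From mathcomp Require Import all_classical.
From mathcomp Require Import topology.

(** In an irreducible space every two nonempty open sets meet, so there is no
  nontrivial clopen set.  Conversely, let [U] be open and nonempty in a
  connected, locally irreducible space.  If a point lies in [closure U], then
  [U] meets the interior [W] of an irreducible neighbourhood of that point, so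
  [U] meets every nonempty open subset of [W] and [W] is contained in
  [closure U].  Thus [closure U] is clopen, hence the whole space, and [U]
  meets every nonempty open set. *)

Local Open Scope classical_set_scope.

Lemma irreducible_spaceP (T : topologicalType) :
  irreducible_space T <->
  [set: T] !=set0 /\ forall U V : set T, open U -> open V ->
    U !=set0 -> V !=set0 -> U `&` V !=set0.
Proof.
split=> [irrT|[T0 meetT] F /finite_seqP[s ->] Fop].
  split=> [|U V oU oV U0 V0].
    (* The intersection of the empty family is the whole space, which yields a point. *)
    have [x _] := irrT set0 (finite_set0 _) (fun U => False_ind _).
    by exists x.
  have [|W [->|->] //|x] := irrT [set U; V]; first exact: finite_set2.
  by rewrite bigcap_setU !bigcap_set1; exists x.
(* Openness is carried through the induction so that [meetT] applies to the head and the
   intersection of the tail. *)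
suff [] : open (\bigcap_(U in [set` s]) U) /\ \bigcap_(U in [set` s]) U !=set0.
  by [].
elim: s Fop => [_|U s IHs Fop].
  rewrite set_nil bigcap_set0; split; first exact: openT.
  exact: T0.
have -> : [set` U :: s] = U |` [set` s].
  by apply/seteqP; split=> V /=; rewrite inE => /predU1P.
rewrite bigcap_setU1.
have [oU U0] : open U /\ U !=set0 by apply: Fop => /=; rewrite mem_head.
have [V /= sV|oI I0] := IHs; first by apply: Fop; rewrite /= inE sV orbT.
by split; [exact: openI|exact: meetT].
Qed.

(** The open sets of [set_type A] are the preimages under [set_val] of open sets of [T], so the
    pairwise criterion can be tested inside [T]. *)
Lemma irreducible_setP (T : topologicalType) (A : set T) :
  irreducible_set A <->
  A !=set0 /\ forall U V : set T, open U -> open V ->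
    A `&` U !=set0 -> A `&` V !=set0 -> A `&` (U `&` V) !=set0.
Proof.
split=> [/irreducible_spaceP[[x _] meetA]|[[x Ax] meetA]].
  split=> [|U V oU oV [u [Au Uu]] [v [Av Vv]]].
    by exists (set_val x); exact: set_valP.
  have [||||y [Uy Vy]] := meetA (set_val @^-1` U) (set_val @^-1` V).
  - by exists U.
  - by exists V.
  - by exists (SigSub (mem_set Au)).
  - by exists (SigSub (mem_set Av)).
  - by exists (set_val y); split; [exact: set_valP|].
apply/irreducible_spaceP; split; first by exists (SigSub (mem_set Ax)).
move=> _ _ [U oU <-] [V oV <-] [u Uu] [v Vv].
have [||y [Ay [Uy Vy]]] := meetA U V oU oV.
- by exists (set_val u); split; [exact: set_valP|].
- by exists (set_val v); split; [exact: set_valP|].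
- by exists (SigSub (mem_set Ay)).
Qed.

Lemma irreducible_connected (T : topologicalType) :
  irreducible_space T -> connected [set: T].
Proof.
move=> /irreducible_spaceP[_ meetT] B B0 [C oC BC] [D cD BD].
(* Relative to the whole space, [B] itself is both open and closed. *)
move: BC BD; rewrite !setTI => BC BD; subst C D.
apply/seteqP; split=> // x _; apply: contrapT => nBx.
have [|y [By nBy]] := meetT B (~` B) oC (closed_openC cD) B0; first by exists x.
exact: nBy.
Qed.

Lemma irreducible_locally_irreducible (T : topologicalType) :
  irreducible_space T -> locally_irreducible T.
Proof.
move=> /irreducible_spaceP[T0 meetT] x; exists [set: T]; first exact: filterT.
by apply/irreducible_setP; split=> // U V; rewrite !setTI; exact: meetT.
Qed.

Lemma locally_irreducible_open_closure (T : topologicalType) (U : set T) :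
  locally_irreducible T -> open U -> open (closure U).
Proof.
move=> locT oU; rewrite openE => x clUx.
have [N nbN /irreducible_setP[_ meetN]] := locT x.
have [u [Uu Nu]] := clUx _ (nbhs_interior nbN).
apply: filterS (nbhs_interior nbN) => y Ny B nbB.
(* Both open sets meet [N], at [u] and at [y], so irreducibility of [N] gives a point of [U] in
   [B]. *)
have [|||z [_ [Uz [_ Bz]]]] := meetN U (N^° `&` B^°) oU.
- by apply: openI; exact: open_interior.
- by exists u; split=> //; exact: interior_subset.
- by exists y; split; [exact: interior_subset|split].
- by exists z; split=> //; exact: interior_subset.
Qed.

Theorem mainTheorem3 (T : topologicalType) :
  irreducible_space T <->
  [set: T] !=set0 /\ connected [set: T] /\ locally_irreducible T.
Proof.
split=> [irrT|[T0 [connT locT]]].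
  split; first by have /irreducible_spaceP[] := irrT.
  by split; [exact: irreducible_connected|exact: irreducible_locally_irreducible].
apply/irreducible_spaceP; split=> // U V oU oV [u Uu] [v Vv].
have clUT : closure U = [set: T].
  apply: connT; first by exists u; exact: subset_closure.
  - exists (closure U); last by rewrite setTI.
    exact: locally_irreducible_open_closure.
  - by exists (closure U); [exact: closed_closure|rewrite setTI].
(* Unfolded, this says that every neighbourhood of [v] meets [U]; [V] is one. *)
have : closure U v by rewrite clUT.
by apply; exact: open_nbhs_nbhs.
Qed.
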